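(* Let $\lambda>0$, $\delta\ge 0$, $X\subseteq\mathbb{R}^n$, and $f:\mathbb{R}^n\to\mathbb{R}$. Consider the problems $\mathrm{REG}(\lambda)$, $\mathrm{CONS}(k)$ and $\mathrm{MIN}(\delta)$ defined by $X$ and $f$ (see context). 1. If $x^*$ is an optimal solution of $\mathrm{REG}(\lambda)$, then $x^*$ is also an optimal solution of $\mathrm{CONS}(k)$ for $k=\|x^*\|_0$ and an optimal solution of $\mathrm{MIN}(\delta)$ for $\delta=f(x^* )$. The reverse implications are not true in general: there exist $n$, $X$, $f$ and a point $x^*\in X$ that is optimal for $\mathrm{CONS}(k)$ with $k=\|x^*\|_0$, but is not optimal for $\mathrm{REG}(\lambda)$ for any $\lambda>0$; and there exist $n$, $X$, $f$ and a point $x^*\in X$ that is optimal for $\mathrm{MIN}(\delta)$ with $\delta=f(x^* )$, but is not optimal for $\mathrm{REG}(\lambda)$ for any $\lambda>0$. 2. Let $k\in\mathbb{N}$. If all optimal solutions $x^*$ of $\mathrm{CONS}(k)$ have the same cardinality $\|x^*\|_0$, then every optimal solution $x^*$ of $\mathrm{CONS}(k)$ is also an optimal solution of $\mathrm{MIN}(\delta)$ for $\delta=f(x^* )$. The equal-cardinality assumption cannot be dropped in general: there exist $n$, $X$, $f$, $k$ and an optimal solution $x^*$ of $\mathrm{CONS}(k)$ that is not an optimal solution of $\mathrm{MIN}(f(x^* ))$. 3. If all optimal solutions $x^*$ of $\mathrm{MIN}(\delta)$ have the same function value $f(x^* )$, then every optimal solution $x^*$ of $\mathrm{MIN}(\delta)$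 is also an optimal solution of $\mathrm{CONS}(k)$ for $k=\|x^*\|_0$. The equal-value assumption cannot be dropped in general: there exist $n$, $X$, $f$, $\delta\ge 0$ and an optimal solution $x^*$ of $\mathrm{MIN}(\delta)$ that is not an optimal solution of $\mathrm{CONS}(\|x^*\|_0)$.
   Context: For $x\in\mathbb{R}^n$, $\|x\|_0=|\{j: x_j\neq 0\}|$ denotes the number of nonzero entries of $x$ (its cardinality). Given $X\subseteq\mathbb{R}^n$ and $f:\mathbb{R}^n\to\mathbb{R}$, define the following optimization problems over $x$: - $\mathrm{REG}(\lambda)$, for real $\lambda>0$: minimize $\|x\|_0+\tfrac{1}{\lambda}f(x)$ subject to $x\in X$. - $\mathrm{CONS}(k)$, for an integer $k\ge 0$: minimize $f(x)$ subject to $\|x\|_0\le k$, $x\in X$. - $\mathrm{MIN}(\delta)$, for real $\delta$: minimize $\|x\|_0$ subject to $f(x)\le\delta$, $x\in X$. An optimal solution of a problem is a feasible point attaining the minimum objective value over all feasible points. Here $\mathbb{N}$ includes $0$. *)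

(* Defs.v *)
From HB Require Import structures.
From mathcomp Require Import all_boot all_order all_algebra.
From mathcomp Require Import classical_sets reals.

Set Implicit Arguments.
Unset Strict Implicit.
Unset Printing Implicit Defensive.

Import Order.TTheory GRing.Theory Num.Theory.
Local Open Scope classical_set_scope.
Local Open Scope ring_scope.

Definition l0norm (R : realType) (n : nat) (x : 'rV[R]_n) : nat :=
  #|[pred j : 'I_n | x ord0 j != 0]|.

(* The objective may take values in any ordered type: it is real-valued in
   REG and CONS, and natural-valued in MIN. *)
Definition optimal (d : Order.disp_t) (V : porderType d) (T : Type)
    (obj : T -> V) (feasible : set T) (x : T) : Prop :=
  feasible x /\ forall y : T, feasible y -> (obj x <= obj y)%O.

Definition REG_optimal (R : realType) (n : nat) (X : set 'rV[R]_n)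
    (f : 'rV[R]_n -> R) (lambda : R) : 'rV[R]_n -> Prop :=
  optimal (fun x : 'rV[R]_n => (l0norm x)%:R + 1 / lambda * f x) X.

Definition CONS_optimal (R : realType) (n : nat) (X : set 'rV[R]_n)
    (f : 'rV[R]_n -> R) (k : nat) : 'rV[R]_n -> Prop :=
  optimal f [set x : 'rV[R]_n | (l0norm x <= k)%N /\ X x].

Definition MIN_optimal (R : realType) (n : nat) (X : set 'rV[R]_n)
    (f : 'rV[R]_n -> R) (delta : R) : 'rV[R]_n -> Prop :=
  optimal (@l0norm R n) [set x : 'rV[R]_n | f x <= delta /\ X x].

(* Main.v *)
Require Import Defs.
From HB Require Import structures.
From mathcomp Require Import all_boot all_order all_algebra.
From mathcomp Require Import classical_sets reals.

(* If y is no worse than an optimal x in one of the two criteria (cardinality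
   or value), optimality of x bounds y in the other one; in 2 and 3 a y that
   strictly improves the other criterion would itself be optimal, so the
   uniqueness hypothesis rules it out.  Two one-dimensional examples, both at
   x = 1, suffice: for f = 0 the point 1 is optimal for CONS(1) but not for
   MIN(0), and for f(t) = 1 - t it is optimal for MIN(0) but not for CONS(1).
   By the implications REG => MIN and REG => CONS, neither is optimal for any
   REG(lambda). *)

Set Implicit Arguments.
Unset Strict Implicit.
Unset Printing Implicit Defensive.

Import Order.TTheory GRing.Theory Num.Theory.
Local Open Scope classical_set_scope.
Local Open Scope ring_scope.

Section Implications.

Variables (R : realType) (n : nat) (X : set 'rV[R]_n) (f : 'rV[R]_n -> R).

Lemma REG_optimal_CONS (lambda : R) (x : 'rV[R]_n) :
  0 < lambda -> REG_optimal X f lambda x -> CONS_optimal X f (l0norm x) x.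
Proof.
move=> lambda0 [Xx xmin]; split=> // y [yx Xy].
(* Scaling by [1 / lambda] and adding [l0norm x] to both sides turns the left side into the REG
   objective at [x]; the right side dominates that objective at [y], as [l0norm y <= l0norm x]. *)
rewrite -(ler_pM2l (divr_gt0 ltr01 lambda0)) -(lerD2l (l0norm x)%:R).
by rewrite (le_trans (xmin y Xy))// lerD2r ler_nat.
Qed.

Lemma REG_optimal_MIN (lambda : R) (x : 'rV[R]_n) :
  0 < lambda -> REG_optimal X f lambda x -> MIN_optimal X f (f x) x.
Proof.
move=> lambda0 [Xx xmin]; split=> [|y [yx Xy]]; first by split.
rewrite leEnat -(ler_nat R) -(lerD2r (1 / lambda * f x)).
by rewrite (le_trans (xmin y Xy))// lerD2l ler_pM2l// divr_gt0.
Qed.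

Lemma CONS_optimal_MIN (k : nat) (x : 'rV[R]_n) :
  (forall y z, CONS_optimal X f k y -> CONS_optimal X f k z ->
     l0norm y = l0norm z) ->
  CONS_optimal X f k x -> MIN_optimal X f (f x) x.
Proof.
move=> same xopt; have [[xk Xx] xmin] := xopt.
split=> [|y [yx Xy]]; first by split.
rewrite leEnat leqNgt; apply/negP => ltyx.
(* A sparser [y] still meets the bound [k], and [f y <= f x] makes it a minimizer too. *)
have yopt : CONS_optimal X f k y.
  split=> [|z /xmin]; last exact: le_trans.
  by split=> //; exact: leq_trans (ltnW ltyx) xk.
by rewrite (same _ _ xopt yopt) ltnn in ltyx.
Qed.

Lemma MIN_optimal_CONS (delta : R) (x : 'rV[R]_n) :
  (forall y z, MIN_optimal X f delta y -> MIN_optimal X f delta z ->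
     f y = f z) ->
  MIN_optimal X f delta x -> CONS_optimal X f (l0norm x) x.
Proof.
move=> same xopt; have [[xdelta Xx] xmin] := xopt.
split=> // y [yx Xy]; rewrite leNgt; apply/negP => ltyx.
(* A smaller value keeps [y] below [delta], and its cardinality does not exceed the minimum
   [l0norm x]. *)
have yopt : MIN_optimal X f delta y.
  split=> [|z /xmin]; last exact: le_trans.
  by split=> //; exact: le_trans (ltW ltyx) xdelta.
by rewrite (same _ _ xopt yopt) ltxx in ltyx.
Qed.

End Implications.

Section Counterexamples.

Variable R : realType.

Lemma l0norm_rV1 (x : 'rV[R]_1) : l0norm x = (x ord0 ord0 != 0).
Proof. by rewrite /l0norm -sum1_card big_mkcond big_ord1 inE; case: ifP. Qed.

Let one : 'rV[R]_1 := const_mx 1.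

Lemma l0norm_one : l0norm one = 1%N.
Proof. by rewrite l0norm_rV1 mxE oner_eq0. Qed.

Lemma CONS_optimal_cst : CONS_optimal setT (fun=> 0 : R) 1 one.
Proof. by split=> //; split; rewrite ?l0norm_one. Qed.

(** The zero vector has the same value and cardinality 0. *)
Lemma not_MIN_optimal_cst : ~ MIN_optimal setT (fun=> 0 : R) 0 one.
Proof.
by move=> [_ /(_ 0 (conj (lexx _) I))]; rewrite l0norm_one l0norm_rV1 mxE eqxx.
Qed.

Let dec (x : 'rV[R]_1) : R := 1 - x ord0 ord0.

Lemma dec_one : dec one = 0.
Proof. by rewrite /dec mxE subrr. Qed.

Lemma MIN_optimal_dec : MIN_optimal setT dec 0 one.
Proof.
split=> [|y [y1 _]]; first by split=> //; rewrite dec_one.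
(* Feasibility forces the entry of [y] to be at least 1, hence nonzero. *)
rewrite subr_le0 in y1.
by rewrite l0norm_one l0norm_rV1 (gt_eqF (lt_le_trans ltr01 y1)).
Qed.

Lemma not_CONS_optimal_dec : ~ CONS_optimal setT dec 1 one.
Proof.
(* The entry 2 costs no extra cardinality and lowers [dec] from 0 to -1. *)
have two : (l0norm (const_mx 2%R : 'rV[R]_1) <= 1)%N by rewrite l0norm_rV1 leq_b1.
move=> [_ /(_ _ (conj two I))].
by rewrite dec_one /dec mxE subr_ge0 lern1.
Qed.

End Counterexamples.

Theorem proposition1p1 (R : realType) :
  (* 1 *)
  ((forall (n : nat) (X : set 'rV[R]_n) (f : 'rV[R]_n -> R) (lambda : R),
      0 < lambda ->
      forall x : 'rV[R]_n, REG_optimal X f lambda x ->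
        CONS_optimal X f (l0norm x) x /\ MIN_optimal X f (f x) x)
   /\ (exists (n : nat) (X : set 'rV[R]_n) (f : 'rV[R]_n -> R) (x : 'rV[R]_n),
      [/\ X x, CONS_optimal X f (l0norm x) x &
          forall lambda : R, 0 < lambda -> ~ REG_optimal X f lambda x])
   /\ (exists (n : nat) (X : set 'rV[R]_n) (f : 'rV[R]_n -> R) (x : 'rV[R]_n),
      [/\ X x, MIN_optimal X f (f x) x &
          forall lambda : R, 0 < lambda -> ~ REG_optimal X f lambda x]))
  /\
  (* 2 *)
  ((forall (n : nat) (X : set 'rV[R]_n) (f : 'rV[R]_n -> R) (k : nat),
      (forall x y : 'rV[R]_n,
         CONS_optimal X f k x -> CONS_optimal X f k y -> l0norm x = l0norm y) ->
      forall x : 'rV[R]_n, CONS_optimal X f k x -> MIN_optimal X f (f x) x)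
   /\ (exists (n : nat) (X : set 'rV[R]_n) (f : 'rV[R]_n -> R) (k : nat)
         (x : 'rV[R]_n),
      CONS_optimal X f k x /\ ~ MIN_optimal X f (f x) x))
  /\
  (* 3 *)
  ((forall (n : nat) (X : set 'rV[R]_n) (f : 'rV[R]_n -> R) (delta : R),
      0 <= delta ->
      (forall x y : 'rV[R]_n,
         MIN_optimal X f delta x -> MIN_optimal X f delta y -> f x = f y) ->
      forall x : 'rV[R]_n,
        MIN_optimal X f delta x -> CONS_optimal X f (l0norm x) x)
   /\ (exists (n : nat) (X : set 'rV[R]_n) (f : 'rV[R]_n -> R) (delta : R)
         (x : 'rV[R]_n),
      [/\ 0 <= delta, MIN_optimal X f delta x &
          ~ CONS_optimal X f (l0norm x) x])).
Proof.
split; [split; [|split]|split; split].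
- move=> n X f lambda lambda0 x xopt; split.
    exact: REG_optimal_CONS lambda0 xopt.
  exact: REG_optimal_MIN lambda0 xopt.
- exists 1%N, setT, (fun=> 0), (const_mx 1); split=> [//||].
    by rewrite l0norm_one; exact: CONS_optimal_cst.
  by move=> lambda lambda0 /(REG_optimal_MIN lambda0); exact: not_MIN_optimal_cst.
- exists 1%N, setT, (fun x => 1 - x ord0 ord0), (const_mx 1); split=> //.
    (* The pattern selects the threshold, the value of the objective at the point, which is 0. *)
    by rewrite [X in MIN_optimal _ _ X]dec_one; exact: MIN_optimal_dec.
  move=> lambda lambda0 /(REG_optimal_CONS lambda0).
  by rewrite l0norm_one; exact: not_CONS_optimal_dec.
- by move=> n X f k same x; exact: CONS_optimal_MIN.
- exists 1%N, setT, (fun=> 0), 1%N, (const_mx 1).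
  by split; [exact: CONS_optimal_cst|exact: not_MIN_optimal_cst].
- by move=> n X f delta _ same x; exact: MIN_optimal_CONS.
- exists 1%N, setT, (fun x => 1 - x ord0 ord0), 0, (const_mx 1); split=> //.
    exact: MIN_optimal_dec.
  by rewrite l0norm_one; exact: not_CONS_optimal_dec.
Qed.
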